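(* As $A\to2$ in a sufficiently small punctured complex disk around $2$, $$P(A,3)=\frac{22}{45(A-2)^2}+\frac{61}{180(A-2)}+O(1).$$ The cycle $Z(A,3)$ is generic throughout that punctured disk.
   Context: Configurations: let $\omega$ be a nondegenerate alternating bilinear form on $V=\mathbb C^4$. A tuple of $n\ge4$ lines in $V$, spanned by $v_0,\dots,v_{n-1}$, is generic if all $a_{ij}=\omega(v_i,v_j)$ ($i\ne j$) are nonzero and every four of the lines span $V$. Modulo $G=\mathrm{Sp}(V,\omega)$, generic $5$-tuples are parametrized by the open set $\mathcal U_5\subset(\mathbb C^\times)^5$ of $(u,v,w,x,y)$ for which $y-ux+vw,\ y-x+w,\ y-v+u,\ x-v+1,\ w-u+1$ are all nonzero: the orbit with these parameters is the one having lifts with $a_{01}=a_{02}=a_{03}=a_{04}=a_{12}=1$, $a_{13}=u$, $a_{14}=v$, $a_{23}=w$, $a_{24}=x$, $a_{34}=y$. The function $\mathscr R$: with $[ijkl]=a_{ij}a_{kl}-a_{ik}a_{jl}+a_{il}a_{jk}$ and $r_{ijk}(l,m)=-\dfrac{a_{ik}a_{jk}[ijlm]}{[ijkl][ijkm]}$ (computed with $a_{ji}=-a_{ij}$), put $\mathscr R=\frac1{5!}\sum_{\sigma\in S_5}\operatorname{sgn}(\sigma)\,r_{\sigma(0)\sigma(1)\sigma(2)}(\sigma(3),\sigma(4))$; it is a $G$-invariant rational function, hence a rational function on $\mathcal U_5$. The maps: $\Phi_1(a,b)=(a,-a,b,-b^2,-ab)$ and $\Phi_2(a,b)=(a,ab,b,-b^2,-ab)$,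 with values read as coordinates $(u,v,w,x,y)$. Put $F_j(a,b)=\mathscr R(\Phi_j(a,b))$, $\mathcal G(a,b)=F_2(a,b)-F_1(a,b)$, $\mathcal Q(X,S)=\mathcal G(-X,S)+\mathcal G(XS,S)$, and $$P(A,B)=\mathcal Q(-A^2,B)+\mathcal Q(B^{-2},A)+\mathcal Q(A^{-2},i/B)+\mathcal Q(-B^2,i/A),$$ a rational function of $A,B$. The cycle: $Z(A,B)$ is the formal sum, over the eight pairs $(a,b)$ given by $(-X,S)$ and $(XS,S)$ with $(X,S)\in\{(-A^2,B),(B^{-2},A),(A^{-2},i/B),(-B^2,i/A)\}$, of $[\Phi_2(a,b)]-[\Phi_1(a,b)]$ in the real vector space of generic $5$-tuples modulo $[\sigma\mathbf x]=\operatorname{sgn}(\sigma)[\mathbf x]$ and the action of $G$; thus $P(A,B)$ is the value of $\mathscr R$ on $Z(A,B)$. ''$Z(A,3)$ is generic'' means that all sixteen points $\Phi_j(a,b)$ occurring in it (with $B=3$) lie in $\mathcal U_5$, i.e. represent generic configurations. *)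

(* Defs.v *)
From mathcomp Require Import all_boot all_order all_algebra all_fingroup.
From mathcomp Require Import reals.
From mathcomp Require Export complex.

Set Implicit Arguments.
Unset Strict Implicit.
Unset Printing Implicit Defensive.

Import GRing.Theory.
Local Open Scope ring_scope.

Section Configurations.
Variable C : fieldType.

Definition alternating_form (omega : {biscalar 'rV[C]_4}) : Prop :=
  forall x, omega x x = 0.

(* The left radical is trivial; for an alternating form left and right radicals
   coincide. *)
Definition nondegenerate_form (omega : {biscalar 'rV[C]_4}) : Prop :=
  forall x, (forall y, omega x y = 0) -> x = 0.

(* A tuple of lines is given by spanning vectors v. *)
Definition generic (omega : {biscalar 'rV[C]_4}) (n : nat)
    (v : 'I_n -> 'rV[C]_4) : Prop :=
  (forall i j, i != j -> omega (v i) (v j) != 0) /\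
  (forall f : 'I_4 -> 'I_n, injective f -> row_full (\matrix_k v (f k))).

(* Parameters (u, v, w, x, y). *)
Definition params : Type := (C * C * C * C * C)%type.

Definition in_U5 (p : params) : Prop :=
  let: (u, v, w, x, y) := p in
  [/\ u != 0, v != 0, w != 0, x != 0 & y != 0] /\
  [/\ y - u * x + v * w != 0, y - x + w != 0, y - v + u != 0,
      x - v + 1 != 0 & w - u + 1 != 0].

(* Entries a_ij with i < j of the normalised Gram matrix. *)
Definition upper (p : params) (i j : nat) : C :=
  let: (u, v, w, x, y) := p in
  match i, j with
  | 0, 1 | 0, 2 | 0, 3 | 0, 4 | 1, 2 => 1
  | 1, 3 => u
  | 1, 4 => v
  | 2, 3 => w
  | 2, 4 => x
  | 3, 4 => y
  | _, _ => 0
  end.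

Definition gram (p : params) : 'M[C]_5 :=
  \matrix_(i, j) (upper p i j - upper p j i).

(* p is the parameter of the Sp(omega)-orbit of a generic 5-tuple of lines:
   the v i are the lifts having the normalised values a_ij. *)
Definition represents_generic (omega : {biscalar 'rV[C]_4}) (p : params) :
    Prop :=
  exists v : 'I_5 -> 'rV[C]_4,
    generic omega v /\ forall i j, omega (v i) (v j) = gram p i j.

Definition bracket (a : 'M[C]_5) (i j k l : 'I_5) : C :=
  a i j * a k l - a i k * a j l + a i l * a j k.

Definition rfun (a : 'M[C]_5) (i j k l m : 'I_5) : C :=
  - (a i k * a j k * bracket a i j l m
     / (bracket a i j k l * bracket a i j k m)).

Definition scrR_gram (a : 'M[C]_5) : C :=
  (5`!%:R)^-1 *
  \sum_(s : 'S_5) (-1) ^+ s *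
    rfun a (s (inord 0)) (s (inord 1)) (s (inord 2)) (s (inord 3)) (s (inord 4)).

(* All denominators are nonzero on U_5, so there this is the value of the
   rational function; elsewhere it is a junk value (x / 0 = 0). *)
Definition scrR (p : params) : C := scrR_gram (gram p).

Definition Phi1 (a b : C) : params := (a, - a, b, - b ^+ 2, - (a * b)).
Definition Phi2 (a b : C) : params := (a, a * b, b, - b ^+ 2, - (a * b)).

Definition F1 (a b : C) : C := scrR (Phi1 a b).
Definition F2 (a b : C) : C := scrR (Phi2 a b).
Definition calG (a b : C) : C := F2 a b - F1 a b.
Definition calQ (X S : C) : C := calG (- X) S + calG (X * S) S.

End Configurations.

Section Cycle.
Variable R : realType.

Definition P (A B : R[i]) : R[i] :=
  calQ (- A ^+ 2) B + calQ (B ^- 2) A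
  + calQ (A ^- 2) ('i%C / B) + calQ (- B ^+ 2) ('i%C / A).

Definition XS_pairs (A B : R[i]) : seq (R[i] * R[i]) :=
  [:: (- A ^+ 2, B); (B ^- 2, A); (A ^- 2, 'i%C / B); (- B ^+ 2, 'i%C / A)].

Definition ab_pairs (A B : R[i]) : seq (R[i] * R[i]) :=
  flatten [seq [:: (- XS.1, XS.2); (XS.1 * XS.2, XS.2)] | XS <- XS_pairs A B].

(* A formal real combination of points, as a list of (coefficient, point); it is
   kept before passing to the quotient, so that "the points occurring in Z" are
   the sixteen points of the list. *)
Definition formal_sum : Type := seq (R * params R[i]).

Definition Z (A B : R[i]) : formal_sum :=
  flatten [seq [:: (1, Phi2 ab.1 ab.2); (-1, Phi1 ab.1 ab.2)]
          | ab <- ab_pairs A B].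

Definition scrR_value (z : formal_sum) : R[i] :=
  \sum_(t <- z) t.1%:C%C * scrR t.2.

Lemma P_value (A B : R[i]) : P A B = scrR_value (Z A B).
Proof.
rewrite /P /scrR_value /calQ /calG /F1 /F2.
move: (@scrR R[i]) => f.
have e1 (p : params R[i]) : (1 : R)%:C%C * f p = f p by exact: mul1r.
have eN1 (p : params R[i]) : (-1 : R)%:C%C * f p = - f p.
  by rewrite rmorphN1 mulN1r.
rewrite /Z /ab_pairs /XS_pairs [flatten]lock /= -lock.
rewrite !big_cons big_nil !e1 !eN1 addr0.
by rewrite -!addrA.
Qed.

Definition generic_cycle (omega : {biscalar 'rV[R[i]]_4}) (z : formal_sum) :
    Prop :=
  forall t, t \in z -> in_U5 t.2 /\ represents_generic omega t.2.

End Cycle.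

(* Main.v *)
Require Import Defs.
From mathcomp Require Import all_boot all_order all_algebra all_fingroup.
From mathcomp Require Import reals.
From mathcomp Require Import ring.

Import Order.TTheory GRing.Theory Num.Theory.
Local Open Scope ring_scope.

(* Let a be a 5 x 5 alternating matrix and let q_m be (-1)^m times the Pfaffian
   of a with index m removed.  The bracket [ijkl] is q_m up to the sign of the
   permutation (i j k l m), so every signed summand of R is
   a_ik a_jk q_k / (q_l q_m), without sign.  Since q lies in the kernel of a, the
   sums of a_ik q_i over i vanish, which turns the sum over S_5 into
     R = - (1/30) (sum over i < k of (a_ik q_i q_k)^2) / (q_0 q_1 q_2 q_3 q_4).
   On the images of Phi_1 and Phi_2 the q_m factor, and with B = 3 only four of
   the sixteen points have a vanishing Pfaffian at A = 2: Phi_1 and Phi_2 at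
   (A^2, 3), and Phi_1 at (-1/9, A) and (A/9, A).  Each contributes a double pole
   read off the closed form; all other points stay in U_5 at A = 2.
   A point of U_5 is realised by vectors with the prescribed Gram matrix, and four
   of these vectors are independent because their Pfaffian is nonzero. *)

(** * The function R on U_5 *)

(** Peeling off the image of the first index again and again reduces sums and statements over ['S_5]
    to explicit finite cases. Injectivity suffices, as both sides have [n.+1] factorial elements. *)
Lemma lift_perm_bij (n : nat) :
  bijective (fun js : 'I_n.+1 * 'S_n => lift_perm ord0 js.1 js.2).
Proof.
apply: inj_card_bij; last by rewrite card_prod card_ord !card_Sn factS.
move=> [j s] [j' s'] /= e.
have ej : j = j' by rewrite -(lift_perm_id ord0 j s) e lift_perm_id.
rewrite -{}ej in e *; congr pair; apply/permP => k.
by apply: (@lift_inj _ j); rewrite -!(lift_perm_lift ord0) e.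
Qed.

Lemma big_lift_perm (C : nmodType) (n : nat) (F : 'S_n.+1 -> C) :
  \sum_s F s = \sum_(j < n.+1) \sum_(s : 'S_n) F (lift_perm ord0 j s).
Proof.
rewrite pair_big (reindex _ (onW_bij _ (lift_perm_bij n))).
by apply: eq_bigr => -[].
Qed.

Lemma lift_permP (n : nat) (T : 'S_n.+1 -> Prop) :
  (forall j s, T (lift_perm ord0 j s)) -> forall s, T s.
Proof.
move=> H s; have [g _ gK] := lift_perm_bij n.
by rewrite -(gK s); apply: H.
Qed.

Section GramPfaffians.
Variable C : fieldType.
Implicit Types p : params C.

(* [(-1) ^ m] times the Pfaffian of [gram p] with row and column [m] removed;
   the resulting vector lies in the kernel of [gram p]. *)
Definition signed_pf p (m : nat) : C :=
  let: (u, v, w, x, y) := p in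
  match m with
  | 0 => y - u * x + v * w
  | 1 => - (y - x + w)
  | 2 => y - v + u
  | 3 => - (x - v + 1)
  | _ => w - u + 1
  end.

(** The definition of R uses [inord]; [e0] to [e4] convert to the iterated [lift] on which
    [lift_perm] and [big_ord_recl] compute. *)
Let i0 : 'I_5 := inord 0.
Let i1 : 'I_5 := inord 1.
Let i2 : 'I_5 := inord 2.
Let i3 : 'I_5 := inord 3.
Let i4 : 'I_5 := inord 4.

Let e0 : i0 = ord0. Proof. by apply: val_inj; rewrite /= inordK. Qed.
Let e1 : i1 = lift ord0 ord0. Proof. by apply: val_inj; rewrite /= inordK. Qed.
Let e2 : i2 = lift ord0 (lift ord0 ord0).
Proof. by apply: val_inj; rewrite /= inordK. Qed.
Let e3 : i3 = lift ord0 (lift ord0 (lift ord0 ord0)).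
Proof. by apply: val_inj; rewrite /= inordK. Qed.
Let e4 : i4 = lift ord0 (lift ord0 (lift ord0 (lift ord0 ord0))).
Proof. by apply: val_inj; rewrite /= inordK. Qed.

(** The bracket is the Pfaffian of a 4 x 4 principal submatrix, hence alternating in its indices;
    the proof checks all 120 permutations. *)
Lemma bracket_perm p (s : 'S_5) :
  bracket (gram p) (s i0) (s i1) (s i2) (s i3) = (-1) ^+ s * signed_pf p (s i4).
Proof.
move: s; rewrite e0 e1 e2 e3 e4; case: p => [[[[u v] w] x] y].
apply: lift_permP => j0; apply: lift_permP => j1; apply: lift_permP => j2.
apply: lift_permP => j3; apply: lift_permP => j4 s.
rewrite !(odd_lift_perm, lift_perm_lift, lift_perm_id).
(* After five peelings [s] lies in ['S_0], so it is the identity. *)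
have -> : (s : bool) = false by rewrite (_ : s = 1%g) ?odd_perm1 //; apply/permP => -[].
rewrite (ord1 j4) /bracket !mxE => {j4 s}.
case: j0 => -[|[|[|[|[|//]]]]] lt0; case: j1 => -[|[|[|[|//]]]] lt1;
  case: j2 => -[|[|[|//]]] lt2; case: j3 => -[|[|//]] lt3;
  rewrite /= ?expr0 ?expr1; ring.
Qed.

Lemma signed_pf_neq0 p m : in_U5 p -> signed_pf p m != 0.
Proof.
case: p => [[[[u v] w] x] y] [_ [h0 h1 h2 h3 h4]].
by case: m => [|[|[|[|m]]]] //=; rewrite oppr_eq0.
Qed.

Lemma gram_signed_pf p k : \sum_i gram p i k * signed_pf p i = 0.
Proof.
case: p => [[[[u v] w] x] y]; rewrite !big_ord_recl big_ord0 !mxE.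
by case: k => -[|[|[|[|[|//]]]]] ltk /=; ring.
Qed.

Lemma sign_rfun_perm p (s : 'S_5) : in_U5 p ->
  (-1) ^+ s * rfun (gram p) (s i0) (s i1) (s i2) (s i3) (s i4) =
  gram p (s i0) (s i2) * gram p (s i1) (s i2) * signed_pf p (s i2)
  / (signed_pf p (s i3) * signed_pf p (s i4)).
Proof.
move=> Up; have nz m := signed_pf_neq0 p m Up.
have D : uniq [:: i0; i1; i2; i3; i4] by rewrite e0 e1 e2 e3 e4.
move: D; rewrite /= !inE !negb_or => /and5P[/and4P[n01 n02 n03 n04]].
move=> /and3P[n12 n13 n14] /andP[n23 n24] n34 _.
(* The three brackets of [rfun] omit [s i4], [s i3] and [s i2] in turn; composing with
   transpositions moves the omitted index to the last place. *)
have E0 := bracket_perm p s.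
have E1 := bracket_perm p (tperm i3 i4 * s).
have E2 := bracket_perm p (tperm i2 i4 * (tperm i3 i4 * s)).
rewrite !permM !(tpermL, tpermR) !tpermD // ?(eq_sym i4) ?(eq_sym i3) // in E1.
have n43 : i4 != i3 by rewrite eq_sym.
have n32 : i3 != i2 by rewrite eq_sym.
have n42 : i4 != i2 by rewrite eq_sym.
rewrite !permM tpermL !tpermR (tpermD n23 n43) tpermL (tpermD n32 n42) in E2.
rewrite !tpermD // ?(eq_sym i2) ?(eq_sym i4) ?(eq_sym i3) // in E2.
rewrite !odd_mul_tperm n34 n24 /= negbK in E1 E2.
rewrite /rfun E0 E1 E2; case: (odd_perm s); rewrite /= ?expr1 ?expr0; field;
  by rewrite !nz oppr_eq0 oner_eq0.
Qed.

(* The left-hand side is twice the sum over [k] of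
   [(\sum_i B i k) ^+ 2 - \sum_i B i k ^+ 2]. *)
Lemma sum_perm_pairs (B : nat -> nat -> C) :
  (forall k, B k k = 0) -> (forall k : 'I_5, \sum_(i < 5) B i k = 0) ->
  \sum_(s : 'S_5) B (s i0) (s i2) * B (s i1) (s i2)
  = - (\sum_(i < 5) \sum_(k < 5) B i k ^+ 2) *+ 2.
Proof.
move=> B0 Bsum; rewrite exchange_big /=.
transitivity
  ((\sum_(k < 5) ((\sum_(i < 5) B i k) ^+ 2 - \sum_(i < 5) B i k ^+ 2)) *+ 2).
  rewrite e0 e1 e2 big_lift_perm -sumrMnl.
  under eq_bigr => j0 _.
    rewrite big_lift_perm; under eq_bigr => j1 _.
      rewrite big_lift_perm; under eq_bigr => j2 _.
        under eq_bigr do rewrite !(lift_perm_lift, lift_perm_id).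
        (* The summand ignores the images of the last two indices, so each term occurs [2!]
           times. *)
        rewrite sumr_const card_Sn.
        over.
      over.
    over.
  rewrite (_ : 2`! = 2)%N // !big_ord_recl !big_ord0 /= /bump /= ?(add0n, add1n) /= !B0.
  ring.
congr (_ *+ _); rewrite -sumrN; apply: eq_bigr => k _.
by rewrite Bsum expr0n sub0r.
Qed.

(** With [B i k] equal to [a_ik q_i q_k], each signed summand is [B i k * B j k] over the product of
    all [q]. The sum runs over ordered pairs, which doubles it and halves the factor 1/30. *)
Lemma scrRE p : in_U5 p ->
  scrR p = - (2 / 5`!%:R) *
    (\sum_(i < 5) \sum_(k < 5)
       (gram p i k * signed_pf p i * signed_pf p k) ^+ 2)
    / \prod_(i < 5) signed_pf p i.
Proof.
move=> Up; have nz m := signed_pf_neq0 p m Up.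
pose B (i k : nat) := (upper p i k - upper p k i) * signed_pf p i * signed_pf p k.
have BE (i k : 'I_5) : B i k = gram p i k * signed_pf p i * signed_pf p k.
  by rewrite /B mxE.
have B0 k : B k k = 0 by rewrite /B subrr !mul0r.
have Bsum (k : 'I_5) : \sum_(i < 5) B i k = 0.
  under eq_bigr do rewrite BE.
  by rewrite -mulr_suml gram_signed_pf mul0r.
have sE (s : 'S_5) :
    (-1) ^+ s * rfun (gram p) (s i0) (s i1) (s i2) (s i3) (s i4) =
    B (s i0) (s i2) * B (s i1) (s i2) / \prod_(i < 5) signed_pf p i.
  rewrite sign_rfun_perm // !BE (reindex_inj (@perm_inj _ s)) /=.
  rewrite !big_ord_recl big_ord0 -e4 -e3 -e2 -e1 -e0.
  by field; rewrite !nz.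
rewrite /scrR /scrR_gram (eq_bigr _ (fun s _ => sE s)) -mulr_suml.
rewrite (sum_perm_pairs _ B0 Bsum).
under eq_bigr do under eq_bigr do rewrite BE.
rewrite mulr2n; ring.
Qed.

End GramPfaffians.

(** * Points of U_5 represent generic configurations *)

(** Sending [ord_max] to the one value that [f] misses completes it to a permutation; thus
    [bracket_perm] applies to any four of the five vectors. *)
Lemma inj_extend_perm (n : nat) (f : 'I_n -> 'I_n.+1) : injective f ->
  exists s : 'S_n.+1, forall k, s (lift ord_max k) = f k.
Proof.
move=> f_inj; have [m mf] : exists m, m \notin codom f.
  apply/existsP; rewrite -negb_forall; apply/negP => /forallP fsurj.
  have : (#|'I_n.+1| <= #|codom f|)%N by apply/subset_leq_card/subsetP => i _.
  by rewrite card_codom // !card_ord ltnn.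
pose g k := if unlift ord_max k is Some i then f i else m.
have g_inj : injective g.
  move=> i j; rewrite /g; case: unliftP => [i'|] ->; case: unliftP => [j'|] -> //.
  - by move=> /f_inj ->.
  - by move=> e; rewrite -e codom_f in mf.
  - by move=> e; rewrite e codom_f in mf.
by exists (perm g_inj) => k; rewrite permE /g liftK.
Qed.

(** Cramer's rule for alternating matrices: the matrix of complementary entries, suitably signed,
    times [a] is the Pfaffian times the identity. Each of the four cases uses one row of it. *)
Lemma skew4_kernel (C : fieldType) (a : 'I_4 -> 'I_4 -> C) (x : 'I_4 -> C) :
  (forall i j, a i j = - a j i) -> (forall i, a i i = 0) ->
  a 0 1 * a 2 3 - a 0 2 * a 1 3 + a 0 3 * a 1 2 != 0 ->
  (forall l, \sum_k x k * a k l = 0) -> forall k, x k = 0.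
Proof.
set pf := (X in X != 0) => aN a0 pf0 xa k; apply: (mulIf pf0); rewrite mul0r.
pose L l := x 0 * a 0 l + x 1 * a 1 l + x 2 * a 2 l + x 3 * a 3 l.
have L0 l : L l = 0.
  rewrite -[RHS](xa l) !big_ord_recl big_ord0 addr0 !addrA.
  by congr (_ + _ + _ + _); congr (x _ * a _ l); apply: val_inj.
have aE := (a0, aN 1 0, aN 2 0, aN 3 0, aN 2 1, aN 3 1, aN 3 2).
case: k => -[|[|[|[|//]]]] ltk; set k := Ordinal ltk.
- rewrite (_ : k = 0); last exact: val_inj.
  transitivity (L 1 * a 2 3 - L 2 * a 1 3 + L 3 * a 1 2).
    by rewrite /L /pf !aE; ring.
  by rewrite !L0; ring.
- rewrite (_ : k = 1); last exact: val_inj.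
  transitivity (- L 0 * a 2 3 + L 2 * a 0 3 - L 3 * a 0 2).
    by rewrite /L /pf !aE; ring.
  by rewrite !L0; ring.
- rewrite (_ : k = 2); last exact: val_inj.
  transitivity (L 0 * a 1 3 - L 1 * a 0 3 + L 3 * a 0 1).
    by rewrite /L /pf !aE; ring.
  by rewrite !L0; ring.
- rewrite (_ : k = 3); last exact: val_inj.
  transitivity (- L 0 * a 1 2 + L 1 * a 0 2 - L 2 * a 0 1).
    by rewrite /L /pf !aE; ring.
  by rewrite !L0; ring.
Qed.

Section Representation.
Variables (C : fieldType) (omega : {biscalar 'rV[C]_4}).
Hypotheses (omega_alt : alternating_form omega)
  (omega_nondeg : nondegenerate_form omega).

Let omegaDl x y z : omega (x + y) z = omega x z + omega y z.
Proof. by rewrite linearDl. Qed.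

Let omegaDr x y z : omega z (x + y) = omega z x + omega z y.
Proof. by rewrite linearD. Qed.

Let omegaZl a x z : omega (a *: x) z = a * omega x z.
Proof. by rewrite linearZl_LR. Qed.

Let omegaZr a x z : omega z (a *: x) = a * omega z x.
Proof. by rewrite linearZ. Qed.

Let omega_sumr n (F : 'I_n -> 'rV[C]_4) z :
  omega z (\sum_i F i) = \sum_i omega z (F i).
Proof. exact: linear_sumr. Qed.

Let omega_suml n (F : 'I_n -> 'rV[C]_4) z :
  omega (\sum_i F i) z = \sum_i omega (F i) z.
Proof. exact: linear_sumlz. Qed.

Let omegaE := (omegaDl, omegaDr, omegaZl, omegaZr).

Let omegaC x y : omega x y = - omega y x.
Proof.
have := omega_alt (x + y).
by rewrite omegaDl !omegaDr !omega_alt add0r addr0 => /eqP; rewrite addr_eq0 => /eqP.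
Qed.

Lemma exists_dual (x : 'rV[C]_4) : x != 0 -> exists y, omega x y = 1.
Proof.
move=> x0; have [y xy] : exists y, omega x y != 0.
  case: (pickP (fun j => omega x (delta_mx 0 j) != 0)) => [j xj|H].
    by exists (delta_mx 0 j).
  case/eqP: x0; apply: omega_nondeg => y.
  rewrite (row_sum_delta y) omega_sumr big1 // => j _.
  by rewrite omegaZr (eqP (negbFE (H j))) mulr0.
by exists ((omega x y)^-1 *: y); rewrite omegaZr mulVf.
Qed.

(** Two linear conditions on a space of dimension 4: the kernel of a 4 x 2 matrix is nonzero. *)
Lemma exists_orthogonal (x y : 'rV[C]_4) :
  exists2 z, z != 0 & omega z x = 0 /\ omega z y = 0.
Proof.
pose M : 'M[C]_(4, 2) := \matrix_(i, j) omega (delta_mx 0 i) (if j == 0 then x else y).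
have : kermx M != 0.
  by rewrite -mxrank_eq0 mxrank_ker -lt0n subn_gt0 (leq_ltn_trans (rank_leq_col _)).
case/rowV0Pn=> z /sub_kermxP zM z0; exists z => //.
have E (j : 'I_2) : omega z (if j == 0 then x else y) = 0.
  have := congr1 (fun A : 'rV_2 => A 0 j) zM; rewrite !mxE => <-.
  rewrite {1}(row_sum_delta z) omega_suml.
  by apply: eq_bigr => i _; rewrite omegaZl mxE.
by split; [exact: E 0|exact: (E 1)].
Qed.

Lemma exists_symplectic_basis : exists e f e' f' : 'rV[C]_4,
  [/\ omega e f = 1, omega e' f' = 1,
      omega e e' = 0 /\ omega e f' = 0 & omega f e' = 0 /\ omega f f' = 0].
Proof.
have e0 : (delta_mx 0 0 : 'rV[C]_4) != 0.
  apply/eqP => /rowP/(_ 0); rewrite !mxE !eqxx => /eqP.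
  by rewrite oner_eq0.
have [f ef] := exists_dual _ e0; move: (delta_mx 0 0) e0 ef => e e0 ef.
have [e' e'0 [e'e e'f]] := exists_orthogonal e f.
have [g e'g] := exists_dual _ e'0.
(* The corrections make the last vector orthogonal to [e] and [f]; they leave its pairing with [e']
   at 1, since [e'] is orthogonal to both. *)
exists e, f, e', (g + (- omega e g) *: f + (omega f g) *: e).
by rewrite !omegaE e'e e'f e'g ef !omega_alt (omegaC f e) ef (omegaC e e') (omegaC f e')
  e'e e'f; split => //; [|split..]; ring.
Qed.

Lemma in_U5_represents_generic (p : params C) :
  in_U5 p -> represents_generic omega p.
Proof.
move=> Up; have nz m := signed_pf_neq0 _ p m Up.
have [v vE] : exists v : 'I_5 -> 'rV[C]_4,
    forall i j, omega (v i) (v j) = gram p i j.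
  have [e [f [e' [f' [ef e'f' [ee' ef'] [fe' ff']]]]]] := exists_symplectic_basis.
  have fe := omegaC f e; have f'e' := omegaC f' e'.
  have e'e := omegaC e' e; have f'e := omegaC f' e.
  have e'f := omegaC e' f; have f'f := omegaC f' f.
  rewrite ef e'f' ee' ef' fe' ff' ?oppr0 in fe f'e' e'e f'e e'f f'f.
  case: p Up nz => [[[[u v] w] x] y] Up /(_ 4) /= c0.
  (* Triangular solution in the symplectic basis: v_0 = e and v_1 = f are free,
     the other coordinates are forced by the prescribed Gram entries. *)
  exists (fun i => match i : nat with
    | 0 => e
    | 1 => f
    | 2 => (-1) *: e + f + e'
    | 3 => (- u) *: e + f + (w - u + 1) *: f'
    | _ => (- v) *: e + f + ((v - u - y) / (w - u + 1)) *: e' + (x - v + 1) *: f'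
    end) => i j.
  rewrite mxE; case: i => -[|[|[|[|[|//]]]]] lti;
    case: j => -[|[|[|[|[|//]]]]] ltj;
    rewrite /= ?omegaE ?omega_alt ?ef ?e'f' ?ee' ?ef' ?fe' ?ff' ?fe ?f'e' ?e'e ?f'e
      ?e'f ?f'f; by field.
exists v; split => //; split.
  move=> i j; rewrite vE mxE -val_eqE /=.
  case: p Up {nz vE} => [[[[u' v'] w] x] y] [[? ? ? ? ?] _].
  by case: i => -[|[|[|[|[|//]]]]] lti; case: j => -[|[|[|[|[|//]]]]] ltj //= _;
    rewrite ?subr0 ?sub0r ?oppr_eq0 ?oner_eq0.
(* A linear relation [z] among the four vectors, paired with each of them, lies in the kernel of
   their Gram matrix, whose Pfaffian is nonzero. *)
move=> f f_inj; rewrite -col_leq_rank row_leq_rank -kermx_eq0.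
apply/rowV0P => z /sub_kermxP zv0; apply/rowP => k; rewrite mxE.
apply: (skew4_kernel C (fun i j => omega (v (f i)) (v (f j))) (z 0)).
- by move=> i j; apply: omegaC.
- by move=> i; apply: omega_alt.
- have [s sf] := inj_extend_perm _ f f_inj.
  have := bracket_perm C p s; rewrite /bracket.
  rewrite (_ : inord 0 = lift ord_max 0); last by apply: val_inj; rewrite /= inordK.
  rewrite (_ : inord 1 = lift ord_max 1); last by apply: val_inj; rewrite /= inordK.
  rewrite (_ : inord 2 = lift ord_max 2); last by apply: val_inj; rewrite /= inordK.
  rewrite (_ : inord 3 = lift ord_max 3); last by apply: val_inj; rewrite /= inordK.
  by rewrite !sf -!vE => ->; rewrite mulf_neq0 // signr_eq0.
move=> l; transitivity (omega (z *m \matrix_k v (f k)) (v (f l))).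
  rewrite mulmx_sum_row omega_suml; apply: eq_bigr => i _.
  by rewrite omegaZl rowK.
by rewrite zv0 -(scale0r 0) omegaZl mul0r.
Qed.

End Representation.

(** * First order expansions at a point *)

Section Jets.
Variables (K : numFieldType) (c : K).
Implicit Types (f g h : K -> K) (T : K -> Prop).

Definition punctured_near T : Prop :=
  exists2 r, 0 < r & forall z, 0 < `|z - c| < r -> T z.

Definition bounded_near f : Prop :=
  exists2 M, 0 < M & punctured_near (fun z => `|f z| <= M).

(** First order Taylor expansion with remainder O((z - c)^2); the value of [f] at [c] itself does
    not enter. Applied to (z - c)^2 times a function, [a] and [b] are the coefficients of its double
    and simple pole. *)
Definition jet f (a b : K) : Prop :=
  exists2 g, bounded_near g &
    punctured_near (fun z => f z = a + b * (z - c) + (z - c) ^+ 2 * g z).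

Lemma nearT T : (forall z, z != c -> T z) -> punctured_near T.
Proof.
by move=> H; exists 1 => // z /andP[+ _]; rewrite normr_gt0 subr_eq0 => /H.
Qed.

Lemma near_impl T T' :
  punctured_near T -> (forall z, z != c -> T z -> T' z) -> punctured_near T'.
Proof.
move=> [r r0 Tr] H; exists r => // z zr; apply: H (Tr _ zr).
by case/andP: zr; rewrite normr_gt0 subr_eq0.
Qed.

Lemma near_and T T' :
  punctured_near T -> punctured_near T' -> punctured_near (fun z => T z /\ T' z).
Proof.
move=> [r r0 Tr] [s s0 Ts].
(* The order on [K] is partial, but positive elements are real and hence comparable. *)
have [rs|sr] := real_leP (gtr0_real r0) (gtr0_real s0).
- exists r => // z /andP[z0 zr]; split; first by apply: Tr; rewrite z0.
  by apply: Ts; rewrite z0 (lt_le_trans zr).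
- exists s => // z /andP[z0 zs]; split; last by apply: Ts; rewrite z0.
  by apply: Tr; rewrite z0 (lt_trans zs).
Qed.

Lemma bounded_cst (a : K) : bounded_near (fun=> a).
Proof.
exists (`|a| + 1); first by rewrite ltr_wpDl.
by apply: nearT => z _; rewrite lerDl.
Qed.

Lemma bounded_sub : bounded_near (fun z => z - c).
Proof. by exists 1 => //; exists 1 => // z /andP[_ /ltW]. Qed.

Lemma boundedD f g :
  bounded_near f -> bounded_near g -> bounded_near (fun z => f z + g z).
Proof.
move=> [M M0 fM] [N N0 gN]; exists (M + N); first exact: addr_gt0.
apply: near_impl (near_and _ _ fM gN) _ => z _ [? ?].
by rewrite (le_trans (ler_normD _ _)) ?lerD.
Qed.

Lemma boundedM f g :
  bounded_near f -> bounded_near g -> bounded_near (fun z => f z * g z).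
Proof.
move=> [M M0 fM] [N N0 gN]; exists (M * N); first exact: mulr_gt0.
apply: near_impl (near_and _ _ fM gN) _ => z _ [? ?].
by rewrite normrM ler_pM.
Qed.

Lemma bounded_near_eq f g :
  bounded_near g -> punctured_near (fun z => f z = g z) -> bounded_near f.
Proof.
move=> [M M0 gM] fg; exists M => //.
by apply: near_impl (near_and _ _ gM fg) _ => z _ [? ->].
Qed.

Lemma jet_bounded f a b : jet f a b -> bounded_near f.
Proof.
move=> [g gb fE]; apply: bounded_near_eq fE.
have cb := bounded_cst; have sb := bounded_sub.
by apply: boundedD; [apply: boundedD => //|]; apply: boundedM => //; apply: boundedM.
Qed.

Lemma near_small f (e : K) :
  0 < e -> bounded_near f -> punctured_near (fun z => `|(z - c) * f z| < e).
Proof.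
move=> e0 [M M0 fM].
have eM : punctured_near (fun z => `|z - c| < e / M).
  by exists (e / M); [exact: divr_gt0|move=> z /andP[]].
apply: near_impl (near_and _ _ fM eM) _ => z zc [fzM zeM].
rewrite normrM; apply: le_lt_trans (ler_wpM2l (normr_ge0 _) fzM) _.
by rewrite -ltr_pdivlMr.
Qed.

Lemma jet_cst (a : K) : jet (fun=> a) a 0.
Proof.
by exists (fun=> 0); [exact: bounded_cst|apply: nearT => z _; ring].
Qed.

Lemma jet_id : jet id c 1.
Proof.
by exists (fun=> 0); [exact: bounded_cst|apply: nearT => z _; ring].
Qed.

Lemma jetD f g a b a' b' :
  jet f a b -> jet g a' b' -> jet (fun z => f z + g z) (a + a') (b + b').
Proof.
move=> [f' f'b fE] [g' g'b gE]; exists (fun z => f' z + g' z).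
  exact: boundedD.
by apply: near_impl (near_and _ _ fE gE) _ => z _ [-> ->]; ring.
Qed.

Lemma jetM f g a b a' b' :
  jet f a b -> jet g a' b' -> jet (fun z => f z * g z) (a * a') (a * b' + b * a').
Proof.
move=> [f' f'b fE] [g' g'b gE].
have cb := bounded_cst; have sb := bounded_sub.
exists (fun z => b * b' + a * g' z + a' * f' z + (z - c) * (b * g' z + b' * f' z)
          + (z - c) * (z - c) * (f' z * g' z)).
  by do !(exact: sb || exact: cb || apply: boundedD || apply: boundedM).
by apply: near_impl (near_and _ _ fE gE) _ => z _ [-> ->]; ring.
Qed.

Lemma jet_eq f g a b : jet g a b -> punctured_near (fun z => f z = g z) -> jet f a b.
Proof.
move=> [h hb gE] fg; exists h => //.
by apply: near_impl (near_and _ _ gE fg) _ => z _ [? ->].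
Qed.

Lemma jetX f a b n :
  jet f a b -> jet (fun z => f z ^+ n) (a ^+ n) (b * a ^+ n.-1 *+ n).
Proof.
move=> fJ; elim: n => [|n IH]; first exact: jet_cst.
(* At [n = 0] the truncated [n.-1] is harmless, because the term is multiplied by 0. *)
have -> : b * a ^+ n.+1.-1 *+ n.+1 = a * (b * a ^+ n.-1 *+ n) + b * a ^+ n.
  by case: n {IH} => [|n] /=; [ring|rewrite exprS !mulrS; ring].
rewrite exprS; apply: jet_eq (jetM _ _ _ _ _ _ fJ IH) _.
by apply: nearT => z _; rewrite exprS.
Qed.

Lemma jetN f a b : jet f a b -> jet (fun z => - f z) (- a) (- b).
Proof.
move=> [g gb fE]; exists (fun z => -1 * g z).
  by apply: boundedM => //; apply: bounded_cst.
by apply: near_impl fE _ => z _ ->; ring.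
Qed.

(** Near [c] the deviation of [f] from [a] is below half of [|a|]; the triangle inequality does the
    rest. *)
Lemma jet_lower_bound f a b : a != 0 -> jet f a b ->
  punctured_near (fun z => `|a| / 2 <= `|f z|).
Proof.
move=> a0 [g gb fE].
have hb : bounded_near (fun z => b + (z - c) * g z).
  by apply: boundedD; [exact: bounded_cst|exact: boundedM bounded_sub gb].
have e0 : 0 < `|a| / 2 by rewrite divr_gt0 ?normr_gt0.
apply: near_impl (near_and _ _ fE (near_small _ _ e0 hb)) _ => z _ [fz small].
have {}fz : a = f z - (z - c) * (b + (z - c) * g z) by rewrite fz; ring.
have := ler_normB (f z) ((z - c) * (b + (z - c) * g z)); rewrite -fz => le.
have := le_trans le (lerD (lexx _) (ltW small)).
by rewrite -lerBlDr {1}[`|a|]splitr addrK.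
Qed.

Lemma jet_neq0 f a b : a != 0 -> jet f a b -> punctured_near (fun z => f z != 0).
Proof.
move=> a0 /(jet_lower_bound _ _ _ a0); move/near_impl; apply=> z _ /lt_le_trans.
by rewrite -normr_gt0; apply; rewrite divr_gt0 ?normr_gt0.
Qed.

Lemma jetV f a b : jet f a b -> a != 0 -> jet (fun z => (f z)^-1) a^-1 (- (b / a ^+ 2)).
Proof.
move=> fj a0; have lb := jet_lower_bound _ _ _ a0 fj; have nz := jet_neq0 _ _ _ a0 fj.
have fVb : bounded_near (fun z => (f z)^-1).
  have e0 : 0 < `|a| / 2 by rewrite divr_gt0 ?normr_gt0.
  exists (`|a| / 2)^-1; first by rewrite invr_gt0.
  apply: near_impl (near_and _ _ nz lb) _ => z _ [fz0 le].
  by rewrite normfV lef_pV2 // posrE normr_gt0.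
case: fj => g gb fE; have cb := bounded_cst; have sb := bounded_sub.
(* Obtained by solving for the remainder of [1 / f]; it is bounded because [1 / f] is. *)
exists (fun z => (b ^+ 2 / a ^+ 2 + ((z - c) * (b / a ^+ 2) + - a^-1) * g z) * (f z)^-1).
  by do !(exact: sb || exact: cb || apply: boundedD || apply: boundedM).
apply: near_impl (near_and _ _ nz fE) _ => z _ [+ fz].
by rewrite fz => fz0; field; rewrite fz0.
Qed.

End Jets.

(** * The sixteen points of the cycle *)

Section ClosedForms.
Variable K : numFieldType.
Implicit Types (a b d e g : K).

(* Up to signs and repetitions, [disc1] and [disc2] are the products of the
   quantities required to be nonzero in [in_U5 (Phi1 a b)], [in_U5 (Phi2 a b)]. *)
Definition disc1 a b := a * b * (b - 2) * (b + 1 - a) * (1 + a - b ^+ 2).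
Definition disc2 a b :=
  a * b * (2 * b - 1) * (b + 1 - a) * (1 - b ^+ 2 - a * b).

(** Common form of R on both families: up to sign the [q_m] are [a b d], [b e], [a d], [g], [e], and
    [q] is the square of [v / a], where [v] is the second coordinate. *)
Definition scrR_closed a b d e g (q : K) :=
  (2 * b ^+ 2 * d ^+ 2 * e ^+ 2 + 2 * d ^+ 2 * e ^+ 2 + 2 * d ^+ 2 * g ^+ 2
   + 2 * e ^+ 2 * g ^+ 2 + a ^+ 2 * d ^+ 4 + q * e ^+ 4)
  / (30 * d ^+ 2 * e ^+ 2 * g).

Lemma in_U5_Phi1 a b : disc1 a b != 0 -> in_U5 (Phi1 a b).
Proof.
rewrite !mulf_eq0 !negb_or => /andP[/andP[/andP[/andP[a0 b0] d0] e0] g0].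
split; split; rewrite ?oppr_eq0 ?mulf_neq0 ?expf_neq0 //.
- by rewrite (_ : _ + _ = a * b * (b - 2)) ?mulf_neq0 //; ring.
- by rewrite (_ : _ + _ = b * (b + 1 - a)) ?mulf_neq0 //; ring.
- by rewrite (_ : _ + _ = - (a * (b - 2))) ?oppr_eq0 ?mulf_neq0 //; ring.
- by rewrite (_ : _ + _ = 1 + a - b ^+ 2) //; ring.
- by rewrite (_ : _ + _ = b + 1 - a) //; ring.
Qed.

Lemma in_U5_Phi2 a b : disc2 a b != 0 -> in_U5 (Phi2 a b).
Proof.
rewrite !mulf_eq0 !negb_or => /andP[/andP[/andP[/andP[a0 b0] d0] e0] g0].
split; split; rewrite ?oppr_eq0 ?mulf_neq0 ?expf_neq0 //.
- by rewrite (_ : _ + _ = a * b * (2 * b - 1)) ?mulf_neq0 //; ring.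
- by rewrite (_ : _ + _ = b * (b + 1 - a)) ?mulf_neq0 //; ring.
- by rewrite (_ : _ + _ = - (a * (2 * b - 1))) ?oppr_eq0 ?mulf_neq0 //; ring.
- by rewrite (_ : _ + _ = 1 - b ^+ 2 - a * b) //; ring.
- by rewrite (_ : _ + _ = b + 1 - a) //; ring.
Qed.

Lemma scrR_Phi1 a b : disc1 a b != 0 ->
  scrR (Phi1 a b) = scrR_closed a b (b - 2) (b + 1 - a) (1 + a - b ^+ 2) 1.
Proof.
move=> D0; rewrite scrRE; last exact: in_U5_Phi1.
move: D0; rewrite !mulf_eq0 !negb_or => /andP[/andP[/andP[/andP[a0 b0] d0] e0] g0].
rewrite !big_ord_recl !big_ord0 !mxE /= /scrR_closed (_ : 5`! = 120%N) //.
rewrite (_ : - (a * b) - a * - b ^+ 2 + - a * b = a * b * (b - 2)); last ring.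
rewrite (_ : - (a * b) - - b ^+ 2 + b = b * (b + 1 - a)); last ring.
rewrite (_ : - (a * b) - - a + a = - (a * (b - 2))); last ring.
rewrite (_ : - b ^+ 2 - - a + 1 = 1 + a - b ^+ 2); last ring.
rewrite (_ : b - a + 1 = b + 1 - a); last ring.
(* The identity holds with [d], [e], [g] independent of [a] and [b], so [field] need not expand
   them. *)
move: (b - 2) (b + 1 - a) (1 + a - b ^+ 2) d0 e0 g0 => d e g d0 e0 g0.
by field; rewrite a0 b0 d0 e0 g0.
Qed.

Lemma scrR_Phi2 a b : disc2 a b != 0 ->
  scrR (Phi2 a b) =
    scrR_closed a b (2 * b - 1) (b + 1 - a) (1 - b ^+ 2 - a * b) (b ^+ 2).
Proof.
move=> D0; rewrite scrRE; last exact: in_U5_Phi2.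
move: D0; rewrite !mulf_eq0 !negb_or => /andP[/andP[/andP[/andP[a0 b0] d0] e0] g0].
rewrite !big_ord_recl !big_ord0 !mxE /= /scrR_closed (_ : 5`! = 120%N) //.
rewrite (_ : - (a * b) - a * - b ^+ 2 + a * b * b = a * b * (2 * b - 1)); last ring.
rewrite (_ : - (a * b) - - b ^+ 2 + b = b * (b + 1 - a)); last ring.
rewrite (_ : - (a * b) - a * b + a = - (a * (2 * b - 1))); last ring.
rewrite (_ : - b ^+ 2 - a * b + 1 = 1 - b ^+ 2 - a * b); last ring.
rewrite (_ : b - a + 1 = b + 1 - a); last ring.
move: (2 * b - 1) (b + 1 - a) (1 - b ^+ 2 - a * b) d0 e0 g0 => d e g d0 e0 g0.
by field; rewrite a0 b0 d0 e0 g0.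
Qed.

End ClosedForms.

(** Builds an expansion along the syntax of a function, instantiating its coefficients; what remains
    are the nonvanishing conditions for inverses. *)
Ltac jets := repeat first
  [ eassumption | apply: jet_id | apply: jet_cst | apply: jetX
  | apply: jetD | apply: jetN | apply: jetM | apply: jetV ].

(** * Points that stay in U_5 at the limit *)

Section RegularPoints.
Variables (K : numFieldType) (c : K) (a b : K -> K) (a0 a1 b0 b1 : K).
Hypotheses (aJ : jet K c a a0 a1) (bJ : jet K c b b0 b1).

Lemma regular_Phi1 : disc1 K a0 b0 != 0 ->
  punctured_near K c (fun z => in_U5 (Phi1 (a z) (b z))) /\
  exists p p', jet K c (fun z => scrR (Phi1 (a z) (b z))) p p'.
Proof.
move=> D0; have nz : punctured_near K c (fun z => disc1 K (a z) (b z) != 0).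
  apply: (jet_neq0 _ _ _ _ _ D0); rewrite /disc1; jets.
split; first by apply: near_impl nz _ => z _; exact: in_U5_Phi1.
move: D0; rewrite !mulf_eq0 !negb_or => /andP[/andP[/andP[_ d0] e0] g0].
have E := near_impl _ _ _ _ nz (fun z _ => scrR_Phi1 K (a z) (b z)).
do 2!eexists; apply: jet_eq _ E; rewrite /scrR_closed; jets.
by rewrite !mulf_neq0 ?expf_neq0 // pnatr_eq0.
Qed.

Lemma regular_Phi2 : disc2 K a0 b0 != 0 ->
  punctured_near K c (fun z => in_U5 (Phi2 (a z) (b z))) /\
  exists p p', jet K c (fun z => scrR (Phi2 (a z) (b z))) p p'.
Proof.
move=> D0; have nz : punctured_near K c (fun z => disc2 K (a z) (b z) != 0).
  apply: (jet_neq0 _ _ _ _ _ D0); rewrite /disc2; jets.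
split; first by apply: near_impl nz _ => z _; exact: in_U5_Phi2.
move: D0; rewrite !mulf_eq0 !negb_or => /andP[/andP[/andP[_ d0] e0] g0].
have E := near_impl _ _ _ _ nz (fun z _ => scrR_Phi2 K (a z) (b z)).
do 2!eexists; apply: jet_eq _ E; rewrite /scrR_closed; jets.
by rewrite !mulf_neq0 ?expf_neq0 // pnatr_eq0.
Qed.

End RegularPoints.

(** * The four points with a double pole *)

Section PolarPoints.
Variable K : numFieldType.
Implicit Types (f h : K -> K) (p q : K).

Definition polar_part c p q f :=
  bounded_near K c (fun z => f z - (p / (z - c) ^+ 2 + q / (z - c))).

Lemma jet_polar_part c f h p q : jet K c h p q ->
  punctured_near K c (fun z => f z = h z / (z - c) ^+ 2) -> polar_part c p q f.
Proof.
move=> [g gb hE] fE; apply: bounded_near_eq gb _.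
apply: near_impl (near_and _ _ _ _ hE fE) _ => z; rewrite -subr_eq0 => zc [hz ->].
by rewrite hz; field.
Qed.

Lemma jet_near_neq0 c f h p q : jet K c h p q -> p != 0 ->
  (forall z, f z = (z - c) * h z) -> punctured_near K c (fun z => f z != 0).
Proof.
move=> J p0 fE; apply: near_impl (jet_neq0 _ _ _ _ _ p0 J) _ => z zc hz.
by rewrite fE mulf_neq0 // subr_eq0.
Qed.

(** Coefficients found by [jets] are unsimplified; this lemma and [jet_eqv] trade them for explicit
    numbers. *)
Lemma eq_neq0 p q : p = q -> q != 0 -> p != 0.
Proof. by move=> ->. Qed.

Lemma jet_eqv c f p q p' q' : jet K c f p q -> p = p' -> q = q' -> jet K c f p' q'.
Proof. by move=> J <- <-. Qed.

Lemma polar_Phi1_sqr :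
  punctured_near K 2 (fun z => in_U5 (Phi1 (z ^+ 2) 3)) /\
  polar_part 2 (- (1 / 40)) (1 / 240) (fun z => scrR (Phi1 (z ^+ 2) 3)).
Proof.
have nz : punctured_near K 2 (fun z => disc1 K (z ^+ 2) 3 != 0).
  (* Only the factor [b + 1 - a = 4 - z^2] vanishes at 2, to first order; this is the cofactor of
     [z - 2]. *)
  apply: (@jet_near_neq0 _ _ (fun z => - (3 * z ^+ 2 * (z + 2) * (z ^+ 2 - 8)))).
  - jets.
  - by apply: (@eq_neq0 _ (192)); [ring|rewrite ?oppr_eq0 pnatr_eq0].
  - by move=> z; rewrite /disc1; ring.
split; first by apply: near_impl nz _ => z _; exact: in_U5_Phi1.
have nz2 : punctured_near K 2 (fun z => (z + 2) * (z ^+ 2 - 8) != 0).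
  apply: jet_neq0; last jets.
  by apply: (@eq_neq0 _ (- 16)); [ring|rewrite ?oppr_eq0 pnatr_eq0].
(* The closed form multiplied by (z - 2)^2, which cancels against the square of [4 - z^2] in the
   denominator. *)
apply: (@jet_polar_part _ _ (fun z =>
   (20 * (z ^+ 2 - 4) ^+ 2 + 2 * (z ^+ 2 - 8) ^+ 2 + 2 * (z ^+ 2 - 4) ^+ 2 * (z ^+ 2 - 8) ^+ 2
    + z ^+ 4 + (z ^+ 2 - 4) ^+ 4) / (30 * (z + 2) ^+ 2 * (z ^+ 2 - 8)))).
  apply: jet_eqv.
  - jets.
    by apply: (@eq_neq0 _ (-1920)); [ring|rewrite ?oppr_eq0 pnatr_eq0].
  - by field.
  - by rewrite /=; field.
apply: near_impl (near_and _ _ _ _ nz nz2) _ => z; rewrite -subr_eq0 => z2 [D0].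
rewrite mulf_eq0 negb_or => /andP[z2' g0].
have e0 : 4 - z ^+ 2 != 0.
  apply: (@eq_neq0 _ (- ((z - 2) * (z + 2)))); first by ring.
  by rewrite oppr_eq0 mulf_neq0.
by rewrite scrR_Phi1 // /scrR_closed; field; rewrite z2 z2' g0 e0.
Qed.

Lemma polar_Phi2_sqr :
  punctured_near K 2 (fun z => in_U5 (Phi2 (z ^+ 2) 3)) /\
  polar_part 2 (- (1 / 8)) (- (11 / 240)) (fun z => scrR (Phi2 (z ^+ 2) 3)).
Proof.
have nz : punctured_near K 2 (fun z => disc2 K (z ^+ 2) 3 != 0).
  apply: (@jet_near_neq0 _ _ (fun z => 15 * z ^+ 2 * (z + 2) * (3 * z ^+ 2 + 8))).
  - jets.
  - by apply: (@eq_neq0 _ 4800); [ring|rewrite pnatr_eq0].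
  - by move=> z; rewrite /disc2; ring.
split; first by apply: near_impl nz _ => z _; exact: in_U5_Phi2.
have nz2 : punctured_near K 2 (fun z => (z + 2) * (3 * z ^+ 2 + 8) != 0).
  apply: jet_neq0; last jets.
  by apply: (@eq_neq0 _ 80); [ring|rewrite pnatr_eq0].
apply: (@jet_polar_part _ _ (fun z =>
   - (500 * (z ^+ 2 - 4) ^+ 2 + 50 * (3 * z ^+ 2 + 8) ^+ 2
      + 2 * (z ^+ 2 - 4) ^+ 2 * (3 * z ^+ 2 + 8) ^+ 2
      + 625 * z ^+ 4 + 9 * (z ^+ 2 - 4) ^+ 4)
     / (750 * (z + 2) ^+ 2 * (3 * z ^+ 2 + 8)))).
  apply: jet_eqv.
  - jets.
    by apply: (@eq_neq0 _ (750 * 16 * 20)); [ring|rewrite !mulf_neq0 ?pnatr_eq0].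
  - by field.
  - by rewrite /=; field.
apply: near_impl (near_and _ _ _ _ nz nz2) _ => z; rewrite -subr_eq0 => z2 [D0].
rewrite mulf_eq0 negb_or => /andP[z2' g0].
have e0 : 4 - z ^+ 2 != 0.
  apply: (@eq_neq0 _ (- ((z - 2) * (z + 2)))); first by ring.
  by rewrite oppr_eq0 mulf_neq0.
have g0' : -8 - z ^+ 2 * 3 != 0.
  by apply: (@eq_neq0 _ (- (3 * z ^+ 2 + 8))); [ring|rewrite oppr_eq0].
by rewrite scrR_Phi2 // /scrR_closed; field; rewrite z2 z2' g0 g0' e0.
Qed.

Lemma polar_Phi1_V9 :
  punctured_near K 2 (fun z => in_U5 (Phi1 (- (1 / 9)) z)) /\
  polar_part 2 (- (14 / 45)) (- (1 / 5)) (fun z => scrR (Phi1 (- (1 / 9)) z)).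
Proof.
have nz : punctured_near K 2 (fun z => disc1 K (- (1 / 9)) z != 0).
  (* Here the vanishing factor is [b - 2 = z - 2]. *)
  apply: (@jet_near_neq0 _ _ (fun z => - (1 / 9) * z * (z + 10 / 9) * (8 / 9 - z ^+ 2))).
  - jets.
  - by apply: (@eq_neq0 _ (1568 / 729)); [field|rewrite mulf_neq0 ?invr_eq0 ?pnatr_eq0].
  - by move=> z; rewrite /disc1; field.
split; first by apply: near_impl nz _ => z _; exact: in_U5_Phi1.
have nz2 : punctured_near K 2 (fun z => (z + 10 / 9) * (8 / 9 - z ^+ 2) != 0).
  apply: jet_neq0; last jets.
  apply: (@eq_neq0 _ (- (784 / 81))); first by field.
  by rewrite oppr_eq0 mulf_neq0 ?invr_eq0 ?pnatr_eq0.
apply: (@jet_polar_part _ _ (fun z =>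
   (2 * (z ^+ 2 + 1) * (z - 2) ^+ 2 * (z + 10 / 9) ^+ 2
    + 2 * (z - 2) ^+ 2 * (8 / 9 - z ^+ 2) ^+ 2
    + 2 * (z + 10 / 9) ^+ 2 * (8 / 9 - z ^+ 2) ^+ 2
    + 1 / 81 * (z - 2) ^+ 4 + (z + 10 / 9) ^+ 4)
     / (30 * (z + 10 / 9) ^+ 2 * (8 / 9 - z ^+ 2)))).
  apply: jet_eqv.
  - jets.
    apply: (@eq_neq0 _ (- (30 * 28 * 784 / 729))); first by field.
    by rewrite oppr_eq0 !mulf_neq0 ?invr_eq0 ?pnatr_eq0.
  - by field.
  - by rewrite /=; field.
apply: near_impl (near_and _ _ _ _ nz nz2) _ => z; rewrite -subr_eq0 => z2 [D0].
rewrite mulf_eq0 negb_or => /andP[e0 g0].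
have e0' : z * 9 + 10 != 0.
  by apply: (@eq_neq0 _ (9 * (z + 10 / 9))); [field|rewrite mulf_neq0 ?pnatr_eq0].
have g0' : 8 + - z ^+ 2 * 9 != 0.
  by apply: (@eq_neq0 _ (9 * (8 / 9 - z ^+ 2))); [field|rewrite mulf_neq0 ?pnatr_eq0].
by rewrite scrR_Phi1 // /scrR_closed; field; rewrite z2 e0' g0'.
Qed.

Lemma polar_Phi1_V9_mul :
  punctured_near K 2 (fun z => in_U5 (Phi1 (z / 9) z)) /\
  polar_part 2 (- (5 / 18)) (- (17 / 90)) (fun z => scrR (Phi1 (z / 9) z)).
Proof.
have nz : punctured_near K 2 (fun z => disc1 K (z / 9) z != 0).
  apply: (@jet_near_neq0 _ _ (fun z => z ^+ 2 / 9 * (1 + 8 / 9 * z) * (1 + z / 9 - z ^+ 2))).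
  - jets; exact: (pnatr_eq0 _ 9).
  - apply: (@eq_neq0 _ (- (2500 / 729))); first by field.
    by rewrite oppr_eq0 mulf_neq0 ?invr_eq0 ?pnatr_eq0.
  - by move=> z; rewrite /disc1; field.
split; first by apply: near_impl nz _ => z _; exact: in_U5_Phi1.
have nz2 : punctured_near K 2 (fun z => (1 + 8 / 9 * z) * (1 + z / 9 - z ^+ 2) != 0).
  apply: jet_neq0; last jets.
  apply: (@eq_neq0 _ (- (625 / 81))); first by field.
  by rewrite oppr_eq0 mulf_neq0 ?invr_eq0 ?pnatr_eq0.
apply: (@jet_polar_part _ _ (fun z =>
   (2 * (z ^+ 2 + 1) * (z - 2) ^+ 2 * (1 + 8 / 9 * z) ^+ 2
    + 2 * (z - 2) ^+ 2 * (1 + z / 9 - z ^+ 2) ^+ 2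
    + 2 * (1 + 8 / 9 * z) ^+ 2 * (1 + z / 9 - z ^+ 2) ^+ 2
    + 1 / 81 * z ^+ 2 * (z - 2) ^+ 4 + (1 + 8 / 9 * z) ^+ 4)
     / (30 * (1 + 8 / 9 * z) ^+ 2 * (1 + z / 9 - z ^+ 2)))).
  apply: jet_eqv.
  - jets.
    apply: (@eq_neq0 _ (- (30 * 25 * 625 / 729))); first by field.
    by rewrite oppr_eq0 !mulf_neq0 ?invr_eq0 ?pnatr_eq0.
  - by field.
  - by rewrite /=; field.
apply: near_impl (near_and _ _ _ _ nz nz2) _ => z; rewrite -subr_eq0 => z2 [D0].
rewrite mulf_eq0 negb_or => /andP[e0 g0].
have e0' : 9 + 8 * z != 0.
  by apply: (@eq_neq0 _ (9 * (1 + 8 / 9 * z))); [field|rewrite mulf_neq0 ?pnatr_eq0].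
have g0' : 9 + z + - z ^+ 2 * 9 != 0.
  by apply: (@eq_neq0 _ (9 * (1 + z / 9 - z ^+ 2))); [field|rewrite mulf_neq0 ?pnatr_eq0].
by rewrite scrR_Phi1 // /scrR_closed; field; rewrite z2 g0' e0'.
Qed.

End PolarPoints.

(** * Polar parts of the eight pairs and their sum *)

Section CyclePairs.
Variables (K : numFieldType) (iota : K).
Hypothesis iota2 : iota ^+ 2 = -1.
Implicit Types (a b f g : K -> K) (p q : K).

Lemma polar_partD (c : K) f g p q p' q' :
  polar_part K c p q f -> polar_part K c p' q' g ->
  polar_part K c (p + p') (q + q') (fun z => f z + g z).
Proof.
move=> fp gp; apply: bounded_near_eq (boundedD _ _ _ _ fp gp) _.
by apply: nearT => z; rewrite -subr_eq0 => zc; field.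
Qed.

Lemma polar_partN (c : K) f p q :
  polar_part K c p q f -> polar_part K c (- p) (- q) (fun z => - f z).
Proof.
move=> fp; apply: bounded_near_eq (boundedM _ _ _ _ (bounded_cst _ _ (-1)) fp) _.
by apply: nearT => z; rewrite -subr_eq0 => zc; field.
Qed.

Lemma bounded_polar_part (c : K) f : bounded_near K c f -> polar_part K c 0 0 f.
Proof.
move=> fb; apply: bounded_near_eq fb _.
by apply: nearT => z _; rewrite !mul0r addr0 subr0.
Qed.

Definition pair_polar a b p q :=
  punctured_near K 2 (fun z => in_U5 (Phi1 (a z) (b z)) /\ in_U5 (Phi2 (a z) (b z)))
  /\ polar_part K 2 p q (fun z => calG (a z) (b z)).

Lemma pair_polar_ext a b a' b' p q : pair_polar a' b' p q ->
  a =1 a' -> b =1 b' -> pair_polar a b p q.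
Proof.
move=> [U5 Gp] aE bE; split.
  by apply: near_impl U5 _ => z _; rewrite aE bE.
by apply: bounded_near_eq Gp _; apply: nearT => z _; rewrite aE bE.
Qed.

(** [F2] is bounded near 2, so [F2 - F1] has the polar part of [F1] negated. *)
Lemma pair_polar_half a b (a0 a1 b0 b1 : K) p q :
  jet K 2 a a0 a1 -> jet K 2 b b0 b1 -> disc2 K a0 b0 != 0 ->
  punctured_near K 2 (fun z => in_U5 (Phi1 (a z) (b z))) ->
  polar_part K 2 p q (fun z => scrR (Phi1 (a z) (b z))) ->
  pair_polar a b (- p) (- q).
Proof.
move=> aJ bJ D2 U1 F1p; have [U2 [? [? F2j]]] := regular_Phi2 _ _ _ _ _ _ _ _ aJ bJ D2.
split; first exact: near_and.
rewrite -[- p]add0r -[- q]add0r; apply: polar_partD (polar_partN _ _ _ _ F1p).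
exact/bounded_polar_part/(jet_bounded _ _ _ _ _ F2j).
Qed.

Lemma pair_polar_regular a b (a0 a1 b0 b1 : K) :
  jet K 2 a a0 a1 -> jet K 2 b b0 b1 -> disc1 K a0 b0 != 0 -> disc2 K a0 b0 != 0 ->
  pair_polar a b 0 0.
Proof.
move=> aJ bJ D1 D2; have [U1 [? [? F1j]]] := regular_Phi1 _ _ _ _ _ _ _ _ aJ bJ D1.
rewrite -oppr0; apply: pair_polar_half aJ bJ D2 U1 _.
exact/bounded_polar_part/(jet_bounded _ _ _ _ _ F1j).
Qed.

(** If [m + n * iota] vanished, squaring would give [m^2 = - n^2], so the norm would be 0 in
    characteristic 0. *)
Lemma gauss_neq0 p (d : nat) (m n : int) :
  p * d%:R = m%:~R + n%:~R * iota -> m ^+ 2 + n ^+ 2 != 0 -> p != 0.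
Proof.
move=> pE; apply: contra_neq => p0; move/eqP: pE.
rewrite p0 mul0r eq_sym addr_eq0 => /eqP mE.
apply/eqP; rewrite -(intr_eq0 K) rmorphD !rmorphXn /= mE sqrrN exprMn iota2.
by apply/eqP; ring.
Qed.

Lemma pair_polar_sqr_3 : pair_polar (fun z => z ^+ 2) (fun=> 3) (- (1 / 10)) (- (1 / 20)).
Proof.
have [U1 p1] := polar_Phi1_sqr K; have [U2 p2] := polar_Phi2_sqr K.
split; first exact: near_and.
rewrite (_ : - (1 / 10) = - (1 / 8) - - (1 / 40)); last by field.
rewrite (_ : - (1 / 20) = - (11 / 240) - 1 / 240); last by field.
exact: polar_partD p2 (polar_partN _ _ _ _ p1).
Qed.

Lemma pair_polar_N3sqr_3 : pair_polar (fun z => - (3 * z ^+ 2)) (fun=> 3) 0 0.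
Proof.
apply: pair_polar_regular.
- jets.
- jets.
(* The product of the factors of [disc1] at [a = -12], [b = 3]. *)
- by apply: (@eq_neq0 _ _ (12 * 3 * 16 * 20)); [rewrite /disc1; ring|rewrite !mulf_neq0 ?pnatr_eq0].
- by apply: (@eq_neq0 _ _ (- (12 * 3 * 5 * 16 * 28))); [rewrite /disc2; ring|rewrite oppr_eq0 !mulf_neq0 ?pnatr_eq0].
Qed.

Lemma pair_polar_NV9_id : pair_polar (fun=> - (1 / 9)) id (14 / 45) (1 / 5).
Proof.
have [U1 p1] := polar_Phi1_V9 K.
rewrite -[14 / 45]opprK -[1 / 5]opprK; apply: pair_polar_half U1 p1.
- jets.
- jets.
- apply: (@eq_neq0 _ _ (2 * 3 * 28 * 25 / 9 ^+ 3)); first by rewrite /disc2; field.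
  by rewrite !mulf_neq0 ?invr_eq0 ?expf_neq0 ?pnatr_eq0.
Qed.

Lemma pair_polar_div9_id : pair_polar (fun z => z / 9) id (5 / 18) (17 / 90).
Proof.
have [U1 p1] := polar_Phi1_V9_mul K.
rewrite -[5 / 18]opprK -[17 / 90]opprK; apply: pair_polar_half U1 p1.
- jets; exact: (pnatr_eq0 _ 9).
- jets.
- apply: (@eq_neq0 _ _ (- (4 * 3 * 25 * 31 / 9 ^+ 3))); first by rewrite /disc2; field.
  by rewrite oppr_eq0 !mulf_neq0 ?invr_eq0 ?expf_neq0 ?pnatr_eq0.
Qed.

Lemma iota_neq0 : iota != 0.
Proof. by rewrite -sqrf_eq0 iota2 oppr_eq0 oner_eq0. Qed.

Let natr_neq0 n : n.+1%:R != 0 :> K.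
Proof. by rewrite pnatr_eq0. Qed.

Lemma sqr_iota_div n : (iota / n.+1%:R) ^+ 2 = - (n.+1%:R ^- 2).
Proof. by rewrite expr_div_n iota2 mulN1r. Qed.

Lemma pair_polar_NVsqr_iota3 : pair_polar (fun z => - z ^- 2) (fun=> iota / 3) 0 0.
Proof.
have i3 := sqr_iota_div 2; have i0 := iota_neq0.
apply: pair_polar_regular.
- jets; exact: expf_neq0 (natr_neq0 1).
- jets.
- rewrite /disc1 i3 !mulf_neq0 ?oppr_eq0 ?invr_eq0 ?expf_neq0 //.
  (* The factors [b - 2], [b + 1 - a], [1 + a - b^2] at [a = -1/4], [b = iota/3], each given by
     denominator, real and imaginary part. *)
  by apply: (gauss_neq0 _ 3 (-6) 1); [field|].
  by apply: (gauss_neq0 _ 12 15 4); [field|].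
  by apply: (gauss_neq0 _ 36 31 0); [field|].
- rewrite /disc2 i3 !mulf_neq0 ?oppr_eq0 ?invr_eq0 ?expf_neq0 //.
  by apply: (gauss_neq0 _ 3 (-3) 2); [field|].
  by apply: (gauss_neq0 _ 12 15 4); [field|].
  by apply: (gauss_neq0 _ 36 40 3); [field|].
Qed.

Lemma pair_polar_Vsqr_iota3 : pair_polar (fun z => z ^- 2 * (iota / 3)) (fun=> iota / 3) 0 0.
Proof.
have i3 := sqr_iota_div 2; have i0 := iota_neq0.
apply: pair_polar_regular.
- jets; exact: expf_neq0 (natr_neq0 1).
- jets.
- rewrite /disc1 i3 !mulf_neq0 ?oppr_eq0 ?invr_eq0 ?expf_neq0 //.
  by apply: (gauss_neq0 _ 3 (-6) 1); [field|].
  by apply: (gauss_neq0 _ 4 4 1); [field|].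
  by apply: (gauss_neq0 _ 36 40 3); [field|].
- rewrite /disc2 -[_ * _ * (iota / 3)]mulrA -expr2 i3 !mulf_neq0 ?oppr_eq0 ?invr_eq0 ?expf_neq0 //.
  by apply: (gauss_neq0 _ 3 (-3) 2); [field|].
  by apply: (gauss_neq0 _ 4 4 1); [field|].
  by apply: (gauss_neq0 _ 36 41 0); [field|].
Qed.

Lemma pair_polar_9_iotaV : pair_polar (fun=> 9) (fun z => iota / z) 0 0.
Proof.
have i2 := sqr_iota_div 1; have i0 := iota_neq0.
apply: pair_polar_regular.
- jets.
- jets; exact: (natr_neq0 1).
- rewrite /disc1 i2 !mulf_neq0 ?oppr_eq0 ?invr_eq0 ?expf_neq0 //.
  by apply: (gauss_neq0 _ 2 (-4) 1); [field|].
  by apply: (gauss_neq0 _ 2 (-16) 1); [field|].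
  by apply: (gauss_neq0 _ 4 41 0); [field|].
- rewrite /disc2 i2 !mulf_neq0 ?oppr_eq0 ?invr_eq0 ?expf_neq0 //.
  by apply: (gauss_neq0 _ 1 (-1) 1); [field|].
  by apply: (gauss_neq0 _ 2 (-16) 1); [field|].
  by apply: (gauss_neq0 _ 4 5 (-18)); [field|].
Qed.

Lemma pair_polar_N9iotaV_iotaV : pair_polar (fun z => - (9 * (iota / z))) (fun z => iota / z) 0 0.
Proof.
have i2 := sqr_iota_div 1; have i0 := iota_neq0.
apply: pair_polar_regular.
- jets; exact: (natr_neq0 1).
- jets; exact: (natr_neq0 1).
- rewrite /disc1 i2 !mulf_neq0 ?oppr_eq0 ?mulf_neq0 ?invr_eq0 ?expf_neq0 //.
  by apply: (gauss_neq0 _ 2 (-4) 1); [field|].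
  by apply: (gauss_neq0 _ 1 1 5); [field|].
  by apply: (gauss_neq0 _ 4 5 (-18)); [field|].
- rewrite /disc2 i2 !mulf_neq0 ?oppr_eq0 ?mulf_neq0 ?invr_eq0 ?expf_neq0 //.
  by apply: (gauss_neq0 _ 1 (-1) 1); [field|].
  by apply: (gauss_neq0 _ 1 1 5); [field|].
  rewrite mulNr -[9 * _ * _]mulrA -expr2 i2.
  by apply: (gauss_neq0 _ 1 (-1) 0); [field|].
Qed.

Definition XS_seq (z w : K) : seq (K * K) :=
  [:: (- z ^+ 2, w); (w ^- 2, z); (z ^- 2, iota / w); (- w ^+ 2, iota / z)].

Lemma cycle_polar :
  punctured_near K 2 (fun z => forall XS, XS \in XS_seq z 3 ->
    forall ab, ab \in [:: (- XS.1, XS.2); (XS.1 * XS.2, XS.2)] ->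
    in_U5 (Phi1 ab.1 ab.2) /\ in_U5 (Phi2 ab.1 ab.2)) /\
  polar_part K 2 (22 / 45) (61 / 180) (fun z =>
    calQ (- z ^+ 2) 3 + calQ (3 ^- 2) z + calQ (z ^- 2) (iota / 3)
    + calQ (- 3 ^+ 2) (iota / z)).
Proof.
have [U1 G1] : pair_polar (fun z => - - z ^+ 2) (fun=> 3) (- (1 / 10)) (- (1 / 20)).
  by apply: pair_polar_ext pair_polar_sqr_3 _ _ => // z; rewrite opprK.
have [U2 G2] : pair_polar (fun z => - z ^+ 2 * 3) (fun=> 3) 0 0.
  by apply: pair_polar_ext pair_polar_N3sqr_3 _ _ => // z; ring.
have [U3 G3] : pair_polar (fun=> - 3 ^- 2) id (14 / 45) (1 / 5).
  by apply: pair_polar_ext pair_polar_NV9_id _ _ => // z; field.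
have [U4 G4] : pair_polar (fun z => 3 ^- 2 * z) id (5 / 18) (17 / 90).
  by apply: pair_polar_ext pair_polar_div9_id _ _ => // z; field.
have [U5 G5] := pair_polar_NVsqr_iota3; have [U6 G6] := pair_polar_Vsqr_iota3.
have [U7 G7] : pair_polar (fun=> - - 3 ^+ 2) (fun z => iota / z) 0 0.
  by apply: pair_polar_ext pair_polar_9_iotaV _ _ => // z; ring.
have [U8 G8] : pair_polar (fun z => - 3 ^+ 2 * (iota / z)) (fun z => iota / z) 0 0.
  by apply: pair_polar_ext pair_polar_N9iotaV_iotaV _ _ => // z; ring.
split.
  have U12 := near_and _ _ _ _ U1 U2; have U34 := near_and _ _ _ _ U3 U4.
  have U56 := near_and _ _ _ _ U5 U6; have U78 := near_and _ _ _ _ U7 U8.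
  apply: near_impl (near_and _ _ _ _ (near_and _ _ _ _ U12 U34)
    (near_and _ _ _ _ U56 U78)) _.
  move=> z _ [[[? ?] [? ?]] [[? ?] [? ?]]] XS; rewrite !inE.
  by case/or4P=> /eqP -> /= ab; rewrite !inE => /orP[]/eqP ->.
have G12 := polar_partD _ _ _ _ _ _ _ G1 G2.
have G34 := polar_partD _ _ _ _ _ _ _ G3 G4.
have G56 := polar_partD _ _ _ _ _ _ _ G5 G6.
have G78 := polar_partD _ _ _ _ _ _ _ G7 G8.
have := polar_partD _ _ _ _ _ _ _ (polar_partD _ _ _ _ _ _ _
  (polar_partD _ _ _ _ _ _ _ G12 G34) G56) G78.
(* -1/10 + 14/45 + 5/18 = 22/45 and -1/20 + 1/5 + 17/90 = 61/180. *)
by congr polar_part; field.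
Qed.

End CyclePairs.

Theorem proposition7p1 (R : realType) (omega : {biscalar 'rV[R[i]]_4})
    (omega_alt : alternating_form omega) (omega_nondeg : nondegenerate_form omega) :
  exists2 r : R, 0 < r &
    (exists M : R, forall A : R[i], 0 < `|A - 2| < r%:C%C ->
       `|P A 3 - (22 / (45 * (A - 2) ^+ 2) + 61 / (180 * (A - 2)))|
         <= M%:C%C) /\
    (forall A : R[i], 0 < `|A - 2| < r%:C%C -> generic_cycle omega (Z A 3)).
Proof.
have i2 : ('i%C : R[i]) ^+ 2 = -1 by exact: sqr_i.
have [U5 [M M0 PM]] := cycle_polar _ _ i2.
have [r r0 H] := near_and _ _ _ _ U5 PM.
(* Radius and bound come as positive elements of [R[i]]; being real, they descend to [R]. *)
have [r' rE] := complex_realP _ (gtr0_real r0).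
have [M' ME] := complex_realP _ (gtr0_real M0).
move: r0 H {PM M0}; rewrite {}rE {}ME ltcR => r0 H.
exists r' => //; split; [exists M'|] => A /H [HU HP].
  apply: le_trans HP; rewrite le_eqVlt; apply/orP; left; apply/eqP.
  by rewrite /P; congr `|_ - (_ + _)|; rewrite invfM mulrA.
move=> t /flattenP[_ /mapP[ab /flattenP[_ /mapP[XS XSin ->] abin] ->] tin].
have [V1 V2] := HU XS XSin ab abin.
have V : in_U5 t.2 by move: tin; rewrite !inE => /orP[]/eqP ->.
by split => //; apply: in_U5_represents_generic.
Qed.
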